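(* Consider the master problem at a branch-and-price node, its restricted master LP (RMLP) and the associated pricing problem, as defined in the context. Let $v_{\mathrm{heur}}>0$ be the solution value of the pricing heuristic (the objective value of a feasible solution of the pricing problem), let $v_{\mathrm{RMLP}}$ be the optimum of the RMLP, and let $v_{\mathrm{ld}}$ be the current local dual bound for the master problem. If $\frac{v_{\mathrm{RMLP}}}{v_{\mathrm{heur}}}\le v_{\mathrm{ld}}$, then the exact pricing algorithm cannot yield a better local dual bound than $v_{\mathrm{ld}}$; that is, for every dual (upper) bound $v_{\mathrm{price}}$ on the optimal value of the pricing problem, the Farley bound $v_{\mathrm{F}}=\frac{v_{\mathrm{RMLP}}}{v_{\mathrm{price}}}$ satisfies $v_{\mathrm{F}}\le v_{\mathrm{ld}}$, so that the updated bound $\max\{v_{\mathrm{F}},v_{\mathrm{ld}}\}$ equals $v_{\mathrm{ld}}$.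
   Context: Data: items $\mathcal{N}=\{1,\dots,n\}$, $a_i,b_i\ge0$, $\sigma\ge0$, $c>0$. A feasible column is a vector $(d_{1p},\dots,d_{np})\in\{0,1\}^n$ with $\sum_i a_id_{ip}+\sigma\sqrt{\sum_i b_id_{ip}}\le c$. At a node, branching decisions are given by a set $\mathcal{S}$ of item pairs that must be packed together and a set $\mathcal{D}$ of item pairs that must not be packed together; $\mathcal{P}_{\mathcal{S},\mathcal{D}}$ is the set of feasible columns $p$ with $d_{i_1p}=d_{i_2p}$ for all $(i_1,i_2)\in\mathcal{S}$ and $d_{i_1p}+d_{i_2p}\le1$ for all $(i_1,i_2)\in\mathcal{D}$. Master problem: $\min\sum_{p\in\mathcal{P}_{\mathcal{S},\mathcal{D}}}\lambda_p$ subject to $\sum_{p\in\mathcal{P}_{\mathcal{S},\mathcal{D}}}d_{ip}\lambda_p\ge1$ for all $i\in\mathcal{N}$, $\lambda_p\in\{0,1\}$. A local dual bound is a lower bound on its optimal value. RMLP: for a subset $\mathcal{P}'_{\mathcal{S},\mathcal{D}}\subseteq\mathcal{P}_{\mathcal{S},\mathcal{D}}$ (for which the problem is feasible), $\min\sum_{p\in\mathcal{P}'_{\mathcal{S},\mathcal{D}}}\lambda_p$ subject to $\sum_{p\in\mathcal{P}'_{\mathcal{S},\mathcal{D}}}d_{ip}\lambda_p\ge1$ for all $i\in\mathcal{N}$, $\lambda_p\ge0$. Let $\pi_i\ge0$ be the optimal dual values of its covering constraints. Pricing problem: after merging the items that $\mathcal{S}$ forces together into single items (new item set $\mathcal{N}'$,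 with $\pi',a',b'$ the sums of $\pi,a,b$ over the merged items, and $\mathcal{D}'$ the induced conflict pairs), maximize $\sum_{i\in\mathcal{N}'}\pi'_ix_i$ subject to $\sum_{i\in\mathcal{N}'}a'_ix_i+\sigma\sqrt{\sum_{i\in\mathcal{N}'}b'_ix_i}\le c$, $x_{i_1}+x_{i_2}\le1$ for all $(i_1,i_2)\in\mathcal{D}'$, $x\in\{0,1\}^{\mathcal{N}'}$. An exact pricing algorithm produces an upper bound $v_{\mathrm{price}}$ on the optimal value of the pricing problem; from it the Farley bound $v_{\mathrm{F}}=v_{\mathrm{RMLP}}/v_{\mathrm{price}}$ (a local dual bound) is computed and the local dual bound is updated by $v_{\mathrm{ld}}\leftarrow\max\{v_{\mathrm{F}},v_{\mathrm{ld}}\}$. *)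

(* Defs.v *)
From mathcomp Require Import all_boot all_order all_algebra.

Set Implicit Arguments.
Unset Strict Implicit.
Unset Printing Implicit Defensive.

Import Order.TTheory GRing.Theory Num.Theory.
Local Open Scope ring_scope.

(* Optimization over an arbitrary type of candidate solutions: the optimal value
   is attained, and is expressed as a predicate on [v]. *)
Definition is_minimizer (R : rcfType) (T : Type) (feas : T -> Prop)
    (obj : T -> R) (x : T) : Prop :=
  feas x /\ (forall y : T, feas y -> obj x <= obj y).

Definition is_maximizer (R : rcfType) (T : Type) (feas : T -> Prop)
    (obj : T -> R) (x : T) : Prop :=
  feas x /\ (forall y : T, feas y -> obj y <= obj x).

Definition is_min_value (R : rcfType) (T : Type) (feas : T -> Prop)
    (obj : T -> R) (v : R) : Prop :=
  exists2 x : T, is_minimizer feas obj x & v = obj x.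

Definition is_max_value (R : rcfType) (T : Type) (feas : T -> Prop)
    (obj : T -> R) (v : R) : Prop :=
  exists2 x : T, is_maximizer feas obj x & v = obj x.

Definition column (n : nat) := {ffun 'I_n -> bool}.

Definition feasible_column (R : rcfType) (n : nat) (a b : 'I_n -> R)
    (sigma c : R) (d : column n) : bool :=
  \sum_i a i * (d i)%:R + sigma * Num.sqrt (\sum_i b i * (d i)%:R) <= c.

(* P_{S,D} *)
Definition node_columns (R : rcfType) (n : nat) (a b : 'I_n -> R) (sigma c : R)
    (S D : {set 'I_n * 'I_n}) : {set column n} :=
  [set d : column n | [&& feasible_column a b sigma c d,
     [forall e in S, d e.1 == d e.2] &
     [forall e in D, (d e.1 + d e.2 <= 1)%N]]].

(* In the master problem and in the restricted master LP below, only the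
   components of [lambda] indexed by the given column set play a role. *)
Definition master_feasible (n : nat) (P : {set column n})
    (lambda : {ffun column n -> bool}) : Prop :=
  forall i : 'I_n, (1 <= \sum_(p in P) p i * lambda p)%N.

Definition master_obj (R : rcfType) (n : nat) (P : {set column n})
    (lambda : {ffun column n -> bool}) : R :=
  \sum_(p in P) (lambda p)%:R.

Definition local_dual_bound (R : rcfType) (n : nat) (P : {set column n})
    (v : R) : Prop :=
  forall vopt : R,
    is_min_value (master_feasible P) (master_obj R P) vopt -> v <= vopt.

Definition rmlp_feasible (R : rcfType) (n : nat) (P' : {set column n})
    (lambda : column n -> R) : Prop :=
  (forall i : 'I_n, 1 <= \sum_(p in P') (p i)%:R * lambda p) /\
  (forall p : column n, p \in P' -> 0 <= lambda p).

Definition rmlp_obj (R : rcfType) (n : nat) (P' : {set column n})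
    (lambda : column n -> R) : R :=
  \sum_(p in P') lambda p.

(* The LP dual of the restricted master LP, whose variables are the multipliers
   of the covering constraints. *)
Definition rmlp_dual_feasible (R : rcfType) (n : nat) (P' : {set column n})
    (pi : 'I_n -> R) : Prop :=
  (forall p : column n, p \in P' -> \sum_i (p i)%:R * pi i <= 1) /\
  (forall i : 'I_n, 0 <= pi i).

Definition rmlp_dual_obj (R : rcfType) (n : nat) (pi : 'I_n -> R) : R :=
  \sum_i pi i.

Definition optimal_dual_values (R : rcfType) (n : nat) (P' : {set column n})
    (pi : 'I_n -> R) : Prop :=
  is_maximizer (rmlp_dual_feasible P') (@rmlp_dual_obj R n) pi.

(* Merging is transitive: the merged items are the classes of the equivalence
   relation generated by S, so that unconstrained items become singletons. *)
Definition same_item (n : nat) (S : {set 'I_n * 'I_n}) : rel 'I_n :=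
  connect (fun i j => ((i, j) \in S) || ((j, i) \in S)).

Definition merged_items (n : nat) (S : {set 'I_n * 'I_n}) : {set {set 'I_n}} :=
  equivalence_partition (same_item S) [set: 'I_n].

Definition merged_data (R : rcfType) (n : nat) (f : 'I_n -> R)
    (I : {set 'I_n}) : R :=
  \sum_(i in I) f i.

(* If S and D conflict, an induced pair is (I, I), and the constraint
   x_I + x_I <= 1 then excludes the merged item I, as it should. *)
Definition merged_conflicts (n : nat) (S D : {set 'I_n * 'I_n}) :
    {set {set 'I_n} * {set 'I_n}} :=
  [set (pblock (merged_items S) e.1, pblock (merged_items S) e.2) | e in D].

(* Only the components of [x] indexed by [merged_items S] play a role. *)
Definition pricing_feasible (R : rcfType) (n : nat) (a b : 'I_n -> R)
    (sigma c : R) (S D : {set 'I_n * 'I_n}) (x : {ffun {set 'I_n} -> bool}) :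
    Prop :=
  \sum_(I in merged_items S) merged_data a I * (x I)%:R
    + sigma * Num.sqrt (\sum_(I in merged_items S) merged_data b I * (x I)%:R)
    <= c /\
  (forall e, e \in merged_conflicts S D -> (x e.1 + x e.2 <= 1)%N).

Definition pricing_obj (R : rcfType) (n : nat) (S : {set 'I_n * 'I_n})
    (pi : 'I_n -> R) (x : {ffun {set 'I_n} -> bool}) : R :=
  \sum_(I in merged_items S) merged_data pi I * (x I)%:R.

Definition pricing_upper_bound (R : rcfType) (n : nat) (a b : 'I_n -> R)
    (sigma c : R) (S D : {set 'I_n * 'I_n}) (pi : 'I_n -> R) (v : R) : Prop :=
  forall vopt : R,
    is_max_value (pricing_feasible a b sigma c S D) (pricing_obj S pi) vopt ->
    vopt <= v.

Definition farley_bound (R : rcfType) (v_RMLP v_price : R) : R :=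
  v_RMLP / v_price.

(* Main.v *)
(* The pricing problem has finitely many solutions, so its optimal value is
   attained and lies between v_heur and v_price.  Since v_RMLP >= 0, replacing
   v_heur by the larger v_price can only decrease the quotient. *)
Require Import Defs.
From mathcomp Require Import all_boot all_order all_algebra.

Import Order.TTheory GRing.Theory Num.Theory.
Local Open Scope ring_scope.

(** An argmax over a finite type needs a boolean predicate and a starting point: [feasb] decides
    [feas], and [x0] witnesses that the feasible set is nonempty. *)
Lemma maximizer_exists (R : rcfType) (T : finType) (feas : T -> Prop)
    (feasb : pred T) (feasP : forall x, reflect (feas x) (feasb x))
    (obj : T -> R) (x0 : T) :
  feas x0 -> exists x, is_maximizer feas obj x.
Proof.
move=> /feasP fx0; case: (arg_maxP obj fx0) => x /feasP fx max_x.
by exists x; split=> // y /feasP /max_x.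
Qed.

(** Supplies the decision procedure required by [maximizer_exists]; the type of [x] is already
    finite. *)
Lemma pricing_feasibleP (R : rcfType) (n : nat) (a b : 'I_n -> R)
    (sigma c : R) (S D : {set 'I_n * 'I_n}) (x : {ffun {set 'I_n} -> bool}) :
  reflect (pricing_feasible a b sigma c S D x)
    ((\sum_(I in merged_items S) merged_data a I * (x I)%:R
       + sigma * Num.sqrt (\sum_(I in merged_items S) merged_data b I * (x I)%:R)
       <= c)
     && [forall e in merged_conflicts S D, (x e.1 + x e.2 <= 1)%N]).
Proof.
by apply: (iffP andP) => -[knap conf]; split=> //; apply/forall_inP.
Qed.

(** [pricing_upper_bound] speaks only of attained optimal values, so it says nothing until a
    maximizer is exhibited. The feasible [x] guarantees one, and its value lies between that of [x]
    and [v]. *)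
Lemma pricing_obj_le_upper_bound (R : rcfType) (n : nat) (a b : 'I_n -> R)
    (sigma c : R) (S D : {set 'I_n * 'I_n}) (pi : 'I_n -> R) (v : R)
    (x : {ffun {set 'I_n} -> bool}) :
  pricing_upper_bound a b sigma c S D pi v ->
  pricing_feasible a b sigma c S D x -> pricing_obj S pi x <= v.
Proof.
move=> ub fx.
have [y [fy max_y]] := maximizer_exists _ _ _ _
  (pricing_feasibleP R n a b sigma c S D) (pricing_obj S pi) x fx.
by apply: le_trans (max_y x fx) (ub _ _); exists y.
Qed.

Lemma rmlp_value_ge0 (R : rcfType) (n : nat) (P' : {set column n}) (v : R) :
  is_min_value (@rmlp_feasible R n P') (@rmlp_obj R n P') v -> 0 <= v.
Proof. by case=> lambda [[_ lambda_ge0] _] ->; apply: sumr_ge0. Qed.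

Theorem proposition4p1 (R : rcfType) (n : nat) (a b : 'I_n -> R) (sigma c : R)
    (ha : forall i : 'I_n, 0 <= a i) (hb : forall i : 'I_n, 0 <= b i)
    (hsigma : 0 <= sigma) (hc : 0 < c)
    (S D : {set 'I_n * 'I_n})
    (P' : {set column n}) (hP' : P' \subset node_columns a b sigma c S D)
    (hfeas : exists lambda : column n -> R, rmlp_feasible P' lambda)
    (pi : 'I_n -> R) (hpi : optimal_dual_values P' pi)
    (v_RMLP : R)
    (hRMLP : is_min_value (@rmlp_feasible R n P') (@rmlp_obj R n P') v_RMLP)
    (v_heur : R) (hheur_pos : 0 < v_heur)
    (hheur : exists2 x : {ffun {set 'I_n} -> bool},
       pricing_feasible a b sigma c S D x & v_heur = pricing_obj S pi x)
    (v_ld : R) (hld : local_dual_bound (node_columns a b sigma c S D) v_ld)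
    (hle : v_RMLP / v_heur <= v_ld) :
  forall v_price : R, pricing_upper_bound a b sigma c S D pi v_price ->
    farley_bound v_RMLP v_price <= v_ld /\
    Num.max (farley_bound v_RMLP v_price) v_ld = v_ld.
Proof.
move=> v_price ub; have [x fx v_heurE] := hheur.
have heur_le : v_heur <= v_price.
  by rewrite v_heurE; apply: pricing_obj_le_upper_bound ub fx.
have farley_le : farley_bound v_RMLP v_price <= v_ld.
  apply: le_trans hle; apply: ler_wpM2l; first exact: rmlp_value_ge0 hRMLP.
  (* Inversion reverses the order only between numbers of the same sign, and [0^-1] is [0] by
     convention; [v_price] is positive because it is at least [v_heur]. *)
  by rewrite lef_pV2 // posrE // (lt_le_trans hheur_pos).
by split=> //; apply: max_r.
Qed.
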